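(* Fix integers $b,t\ge 1$ and a real $\delta>0$. Then for all sufficiently large $n$ (depending on $b,t,\delta$), \[ \tau_t(K_n^b)\le (1+\delta)tn, \] where $K_n^b$ is the Cartesian product of $b$ copies of the complete graph $K_n$.
   Context: $K_n^b$ has vertex set $[n]^b$, with two vertices adjacent iff they differ in exactly one coordinate (so the distance between two vertices is their Hamming distance). For an integer $t\ge1$, a $t$-tone coloring of a graph $G$ assigns to each vertex $v$ a set $f(v)$ of exactly $t$ colors from a color set $C$ such that $|f(u)\cap f(v)|<d(u,v)$ for all distinct vertices $u,v$, where $d(u,v)$ is the graph distance. $\tau_t(G)$ is the minimum $|C|$ over all $t$-tone colorings of $G$. *)

(* Defs.v *)
From HB Require Import structures.
From mathcomp Require Import all_boot all_order all_algebra.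
From mathcomp Require Import reals.

Set Implicit Arguments.
Unset Strict Implicit.
Unset Printing Implicit Defensive.

Record sgraph := SGraph {
  vertex :> finType;
  adj : rel vertex;
  adj_sym : symmetric adj;
  adj_irr : irreflexive adj }.
Arguments adj {s}.

Section Distance.
Variable G : sgraph.
Implicit Types (u v : G) (k : nat).

Definition has_walk u v k : bool :=
  [exists p : k.-tuple G, path adj u p && (last u p == v)].

(* The least length of a walk from u to v. A shortest walk has fewer than #|G| *)
(* edges; if u and v lie in different components the value #|G| is junk.       *)
Definition gdist u v : nat := find (has_walk u v) (iota 0 #|G|).

Lemma gdist_gt0 u v : u != v -> 0 < gdist u v.
Proof.
move=> nuv; rewrite /gdist; have: 0 < #|G| by apply/card_gt0P; exists u.
case: #|G| => // m _ /=; case: ifP => // /existsP[p /andP[_]].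
by rewrite (tuple0 p) /= (negPf nuv).
Qed.

Lemma gdistP u v m : has_walk u v m ->
  (forall k, has_walk u v k -> m <= k) -> gdist u v = m.
Proof.
move=> wm minm; have ltm : m < #|G|.
  have /existsP[p /andP[pp /eqP lp]] := wm.
  case/shortenP: pp lp => q qq uq _ lq.
  have wq : has_walk u v (size q).
    by apply/existsP; exists (in_tuple q); rewrite /= qq lq eqxx.
  by apply: leq_ltn_trans (minm _ wq) _; have := max_card [in u :: q]; rewrite (card_uniqP uq).
rewrite /gdist; apply/eqP; rewrite eqn_leq; apply/andP; split.
  rewrite leqNgt; apply/negP => /(before_find 0).
  by rewrite nth_iota // add0n wm.
have hs : has (has_walk u v) (iota 0 #|G|).
  by apply/hasP; exists m => //; rewrite mem_iota.
have lt := hs; rewrite has_find size_iota in lt.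
by apply: minm; have := nth_find 0 hs; rewrite nth_iota.
Qed.

End Distance.

Section Tone.
Variables (t : nat) (G : sgraph).

(* Vertices in different components are at infinite distance, so they impose *)
(* no condition.                                                             *)
Definition tone_coloring (k : nat) (f : {ffun G -> {set 'I_k}}) : bool :=
  [forall v, #|f v| == t] &&
  [forall u, forall v, (u != v) && connect adj u v ==>
     (#|f u :&: f v| < gdist u v)].

Definition tone_colorable (k : nat) : bool :=
  [exists f : {ffun G -> {set 'I_k}}, tone_coloring f].

Lemma tone_colorable_ex : exists k, tone_colorable k.
Proof.
pose C : finType := (G * 'I_t)%type; exists #|C|.
pose f := [ffun v : G => [set i : 'I_#|C| | (enum_val i).1 == v]].
apply/existsP; exists f; apply/andP; split.
  apply/forallP => v; apply/eqP.
  have -> : f v = [set enum_rank ((v, j) : C) | j : 'I_t].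
    apply/setP => i; rewrite ffunE inE; apply/eqP/imsetP => [<-|[j _ ->]].
      by exists (enum_val i).2; rewrite // -surjective_pairing enum_valK.
    by rewrite enum_rankK.
  by rewrite card_imset ?card_ord // => i j /enum_rank_inj [].
apply/forallP => u; apply/forallP => v; apply/implyP => /andP[nuv _].
suff -> : f u :&: f v = set0 by rewrite cards0 gdist_gt0.
apply/setP => i; rewrite !ffunE !inE.
by apply/negbTE/negP => /andP[/eqP -> /eqP E]; rewrite E eqxx in nuv.
Qed.

Definition tone_chromatic_number : nat := ex_minn tone_colorable_ex.

End Tone.

Notation "\tau_ t G" := (tone_chromatic_number t G)
  (at level 10, t at level 2, G at level 9, format "\tau_ t  G").

Section Complete.
Variable n : nat.
Definition complete_adj : rel 'I_n := fun i j => i != j.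
Lemma complete_sym : symmetric complete_adj.
Proof. by move=> i j; rewrite /complete_adj /= eq_sym. Qed.
Lemma complete_irr : irreflexive complete_adj.
Proof. by move=> i; rewrite /complete_adj /= eqxx. Qed.
Definition complete_graph : sgraph := SGraph complete_sym complete_irr.
End Complete.

Section CartesianPower.
Variables (G : sgraph) (b : nat).
Definition cart_adj : rel {ffun 'I_b -> G} :=
  fun u v => [exists i, adj (u i) (v i) && [forall (j | j != i), u j == v j]].
Lemma cart_sym : symmetric cart_adj.
Proof.
move=> u v; apply: eq_existsb => i; rewrite adj_sym; congr (_ && _).
by apply: eq_forallb => j /=; congr (_ ==> _); exact: eq_sym.
Qed.
Lemma cart_irr : irreflexive cart_adj.
Proof. by move=> u; apply/existsP => -[i]; rewrite adj_irr. Qed.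
Definition cart_power : sgraph := SGraph cart_sym cart_irr.
End CartesianPower.

Definition Kpow (n b : nat) : sgraph := cart_power (complete_graph n) b.

Section KpowFacts.
Variables n b : nat.
Implicit Types u v w : {ffun 'I_b -> 'I_n}.

Definition hamming u v : nat := #|[set i | u i != v i]|.

Lemma Kpow_adjE (u v : Kpow n b) : adj u v = (hamming u v == 1).
Proof.
apply/existsP/cards1P => -[i].
  case/andP=> ni /forallP H; exists i; apply/setP => j; rewrite !inE.
  by have := H j; case: eqVneq => [->|_ /eqP ->]; rewrite ?eqxx.
move=> E; exists i; apply/andP; split; first by have := set11 i; rewrite -E inE.
apply/forallP => j; apply/implyP => nji; apply/negPn.
by have := in_set1 j i; rewrite -E inE (negPf nji) => ->.
Qed.

Lemma hamming_triangle u v w : hamming u w <= hamming u v + hamming v w.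
Proof.
rewrite (leq_trans _ (leq_card_setU _ _)) // subset_leq_card //.
apply/subsetP => i; rewrite !inE; apply: contraR.
by rewrite negb_or !negbK => /andP[/eqP -> /eqP ->].
Qed.

Lemma Kpow_gdistE (u v : Kpow n b) : gdist u v = hamming u v.
Proof.
apply: gdistP; last first.
  move=> k /existsP[p /andP[pp /eqP <-]]; rewrite -[X in _ <= X](size_tuple p).
  elim: (tval p) u pp => [|x s IH] u.
    by move=> _; rewrite /hamming leqn0 cards_eq0; apply/eqP/setP => i; rewrite !inE eqxx.
  case/andP; rewrite Kpow_adjE => /eqP ux /IH le.
  by apply: leq_trans (hamming_triangle u x _) _; rewrite ux ltnS.
move E: (hamming u v) => m; elim: m u E => [|m IH] u E.
  apply/existsP; exists [tuple]; apply/eqP/ffunP => i /=.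
  move/eqP: E; rewrite cards_eq0 => /eqP /setP /(_ i).
  by rewrite !inE => /negbFE /eqP.
have /card_gt0P[i] : 0 < hamming u v by rewrite E.
rewrite inE => ni.
pose x : {ffun 'I_b -> 'I_n} := [ffun j => if j == i then v i else u j].
have ux : adj (u : Kpow n b) x.
  rewrite Kpow_adjE; apply/cards1P; exists i; apply/setP => j; rewrite !inE ffunE.
  by case: (eqVneq j i) => [->|]; rewrite ?eqxx ?ni.
have /IH/existsP[p /andP[pp lp]] : hamming x v = m.
  apply/eqP; rewrite -eqSS -E /hamming [X in _ == X](cardsD1 i) inE ni add1n eqSS; apply/eqP.
  apply: eq_card => j; rewrite !inE ffunE.
  by case: (eqVneq j i) => [->|]; rewrite ?eqxx.
by apply/existsP; exists [tuple of (x : Kpow n b) :: p]; apply/andP; split=> //; apply/andP.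
Qed.

End KpowFacts.

(* Main.v *)
Require Import Defs.
From mathcomp Require Import all_boot all_order all_algebra.
From mathcomp Require Import reals.
Local Open Scope ring_scope.

(** Reed-Solomon colouring. Pick [m] with [n < m <= n + O(1)] coprime to
    [(b + t - 1)!], so that the differences of [0, ..., b + t - 1] are units of
    Z/m. Read a vertex as the values at [0, ..., b - 1] of a polynomial of
    degree less than [b] over Z/m, and give it the [t] colours (i, value of the
    polynomial at [b + i]), [i < t]. Two distinct such polynomials agree on
    fewer than [b] of the [b + t] nodes, while vertices at distance [d] agree on
    [b - d] of the first [b], so they share fewer than [d] colours. Taking
    [m = 1] modulo [(b + t - 1)!] avoids any appeal to gaps between primes. *)

Import Order.TTheory GRing.Theory Num.Theory.

Set Implicit Arguments.
Unset Strict Implicit.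
Unset Printing Implicit Defensive.

Section Agreement.
Local Open Scope nat_scope.

Definition agreement (I : finType) (T : eqType) (w w' : I -> T) : nat :=
  #|[set i | w i == w' i]|.

Lemma agreement_comp_inj (I : finType) (T T' : eqType) (g : T -> T')
    (w w' : I -> T) :
  injective g -> agreement (g \o w) (g \o w') = agreement w w'.
Proof. by move=> g_inj; apply: eq_card => i; rewrite !inE /= inj_eq. Qed.

Lemma agreement_split_ord (m n : nat) (T : eqType) (w w' : 'I_(m + n) -> T) :
  agreement w w' =
    agreement (w \o @lshift m n) (w' \o @lshift m n) +
    agreement (w \o @rshift m n) (w' \o @rshift m n).
Proof. by rewrite /agreement -!sum1dep_card big_split_ord. Qed.

Lemma agreement_add_hamming (n b : nat) (u v : {ffun 'I_b -> 'I_n}) :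
  agreement u v + hamming u v = b.
Proof.
rewrite -[RHS]card_ord -(cardsC [set i | u i == v i]); congr addn.
by apply: eq_card => i; rewrite !inE.
Qed.

End Agreement.

Section ToneColoring.
Local Open Scope nat_scope.
Variables (t : nat) (G : sgraph).

Lemma tone_chromatic_number_le (k : nat) :
  tone_colorable t G k -> \tau_t G <= k.
Proof. by rewrite /tone_chromatic_number; case: ex_minnP => c _; apply. Qed.

Lemma tone_colorable_finType (C : finType) (f : G -> {set C}) :
    (forall v, #|f v| = t) ->
    (forall u v, u != v -> connect adj u v -> #|f u :&: f v| < gdist u v) ->
  tone_colorable t G #|C|.
Proof.
move=> cardf ltf; apply/existsP; exists [ffun v => enum_rank @: f v].
have rank_inj : injective (@enum_rank C) by exact: enum_rank_inj.
apply/andP; split; first by apply/forallP => v; rewrite ffunE card_imset ?cardf.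
apply/'forall_forallP => u v; apply/implyP => /andP[nuv uv].
rewrite !ffunE -imsetI; last by move=> c c' _ _; exact: rank_inj.
by rewrite card_imset ?ltf.
Qed.

(* Colouring by the graph of a word, so that common colours are agreements. *)
Lemma tone_colorable_words (T : finType) (w : G -> 'I_t -> T) :
    (forall u v, u != v -> connect adj u v ->
       agreement (w u) (w v) < gdist u v) ->
  tone_colorable t G (t * #|T|).
Proof.
move=> ltw; rewrite -[t in t * _]card_ord -card_prod.
apply: (@tone_colorable_finType _ (fun v => [set (i, w v i) | i : 'I_t])).
  by move=> v; rewrite card_imset ?card_ord // => i j [].
move=> u v nuv uv; apply: leq_ltn_trans (ltw u v nuv uv).
rewrite /agreement -(card_imset _ (_ : injective (fun i => (i, w u i)))).
  apply/subset_leq_card/subsetP => c; rewrite inE => /andP[/imsetP[i _ ->]].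
  by case/imsetP => j _ [<- wij]; rewrite imset_f ?inE ?wij.
by move=> i j [].
Qed.

End ToneColoring.

Section Interpolation.
Variable R : comUnitRingType.

Definition exceptional (I : eqType) (a : I -> R) : Prop :=
  forall i j, i != j -> a i - a j \is a GRing.unit.

Lemma exceptional_comp_inj (I J : eqType) (f : J -> I) (a : I -> R) :
  injective f -> exceptional a -> exceptional (a \o f).
Proof. by move=> f_inj exc_a i j nij; apply: exc_a; rewrite inj_eq. Qed.

Lemma exceptional_natr (N : nat) :
  ((N.-1)`!%:R : R) \is a GRing.unit ->
  exceptional (fun i : 'I_N => i%:R : R).
Proof.
move=> unit_fact i j; wlog ltji : i j / (j < i)%N => [wlog_lt nij|_].
  case: (ltngtP i j) (nij) => [ltij _|ltji _|/val_inj ->]; last by rewrite eqxx.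
    by rewrite -opprB unitrN wlog_lt // eq_sym.
  exact: wlog_lt.
rewrite -natrB 1?ltnW //.
have /dvdnP[q def_fact] : (i - j %| (N.-1)`!)%N.
  have i_le : (i <= N.-1)%N by rewrite -ltnS (ltn_predK (ltn_ord i)).
  by rewrite dvdn_fact // subn_gt0 ltji (leq_trans (leq_subr _ _)).
by move: unit_fact; rewrite def_fact natrM unitrM => /andP[].
Qed.

Lemma uniq_roots_exceptional (I : eqType) (a : I -> R) (s : seq I) :
  exceptional a -> uniq s -> uniq_roots (map a s).
Proof.
move=> exc_a; elim: s => //= i s IHs /andP[i_s /IHs ->]; rewrite andbT.
apply/allP => _ /mapP[j j_s ->]; rewrite /diff_roots mulrC eqxx exc_a //.
by apply: contraNneq i_s => <-.
Qed.

Lemma agreement_horner_lt (I : finType) (a : I -> R) (p q : {poly R}) :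
  exceptional a -> p != q ->
  (agreement (fun i => p.[a i]) (fun i => q.[a i]) < size (p - q)%R)%N.
Proof.
move=> exc_a; rewrite -subr_eq0 /agreement cardE => npq.
rewrite -(size_map a) max_ring_poly_roots ?uniq_roots_exceptional ?enum_uniq //.
apply/allP => _ /mapP[i + ->]; rewrite mem_enum inE => /eqP eq_pq.
by rewrite /root !hornerE eq_pq subrr.
Qed.

Definition interp (I : finType) (a x : I -> R) : {poly R} :=
  \sum_i (x i / \prod_(j | j != i) (a i - a j)) *:
    \prod_(j | j != i) ('X - (a j)%:P).

Lemma size_interp (I : finType) (a x : I -> R) : (size (interp a x) <= #|I|)%N.
Proof.
apply: leq_trans (size_sum _ _ _) _; apply/bigmax_leqP => i _.
apply: leq_trans (size_scale_leq _ _) _.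
rewrite (eq_bigl (mem (predC1 i))) // -big_enum size_prod_XsubC -cardE cardC1.
by rewrite prednK //; apply/card_gt0P; exists i.
Qed.

Lemma horner_interp (I : finType) (a x : I -> R) (i : I) :
  exceptional a -> (interp a x).[a i] = x i.
Proof.
move=> exc_a; rewrite horner_sum (bigD1 i) //=.
rewrite [X in _ + X]big1 ?addr0 => [|j nji].
  rewrite hornerZ horner_prod.
  under [X in _ / _ * X]eq_bigr do rewrite hornerXsubC.
  by rewrite divrK // unitr_prod // => j nji; rewrite exc_a // eq_sym.
rewrite hornerZ horner_prod [X in _ / _ * X](bigD1 i) 1?eq_sym //=.
by rewrite hornerXsubC subrr mul0r mulr0.
Qed.

End Interpolation.

Section ReedSolomon.
Variables (R : comUnitRingType) (b t : nat) (a : 'I_(b + t) -> R).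
Hypothesis exc_a : exceptional a.

Definition parity_symbols (x : 'I_b -> R) (i : 'I_t) : R :=
  (interp (a \o lshift t) x).[a (rshift b i)].

Lemma agreement_parity_lt (x y : 'I_b -> R) (j : 'I_b) : x j != y j ->
  (agreement x y + agreement (parity_symbols x) (parity_symbols y) < b)%N.
Proof.
move=> nxy; pose p z := interp (a \o lshift t) z.
have exc_lshift : exceptional (a \o lshift t).
  exact: exceptional_comp_inj (@lshift_inj _ _) exc_a.
have pE z i : (p z).[a (lshift t i)] = z i by exact: horner_interp.
have npxy : p x != p y by apply: contra_neq nxy => pxy; rewrite -!pE pxy.
have size_pB : (size (p x - p y)%R <= b)%N.
  have size_p z : (size (p z) <= b)%N.
    by rewrite (leq_trans (size_interp _ _)) ?card_ord.
  by rewrite (leq_trans (size_polyD _ _)) // size_polyN geq_max !size_p.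
apply: leq_trans size_pB; have := agreement_horner_lt exc_a npxy.
rewrite agreement_split_ord; congr (_ + _ < _)%N.
by apply: eq_card => i; rewrite !inE /= !pE.
Qed.

End ReedSolomon.

Lemma tone_colorable_Kpow (R : finComUnitRingType) (n b t : nat)
    (a : 'I_(b + t) -> R) :
  exceptional a -> (n <= #|R|)%N -> tone_colorable t (Kpow n b) (t * #|R|).
Proof.
move=> exc_a nR; pose g (i : 'I_n) : R := enum_val (widen_ord nR i).
have g_inj : injective g by move=> i j /enum_val_inj[] /val_inj.
pose w (v : Kpow n b) := parity_symbols a (g \o v).
apply: (tone_colorable_words (w := w)).
move=> u v nuv _; rewrite Kpow_gdistE -(ltn_add2l (agreement u v)).
rewrite agreement_add_hamming -(agreement_comp_inj _ _ g_inj).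
have /forallPn[j nuvj] : ~~ [forall j, u j == v j].
  by apply: contraNN nuv => /eqfunP/ffunP/eqP.
by apply: (@agreement_parity_lt _ _ _ _ exc_a _ _ j); rewrite /= inj_eq.
Qed.

Section CoprimeModulus.
Local Open Scope nat_scope.

Lemma tone_chromatic_Kpow_coprime (n b t m : nat) :
  1 < m -> n <= m -> coprime m (b + t).-1`! -> \tau_t (Kpow n b) <= t * m.
Proof.
move=> m_gt1 nm co_m; have cardZm : #|'Z_m| = m by rewrite card_ord Zp_cast.
apply: tone_chromatic_number_le; rewrite -cardZm; apply: tone_colorable_Kpow.
  by apply: exceptional_natr; rewrite unitZpE.
by rewrite cardZm.
Qed.

Lemma exists_coprime_gt (n M : nat) : 0 < n -> 0 < M ->
  exists2 m, n < m <= n + M & coprime m M.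
Proof.
case: n => // n _ M0; exists ((n %/ M).+1 * M).+1.
  by rewrite ltnS ltn_ceil // addSn ltnS mulSn addnC leq_add2r leq_divM.
by rewrite coprime_sym; apply: coprime_dvdl (coprimenS _); exact: dvdn_mull.
Qed.

Lemma tone_chromatic_Kpow_le (n b t : nat) :
  \tau_t (Kpow n b) <= t * (n + (b + t).-1`!.+1).
Proof.
have [m /andP[nm m_le] co_m] :=
  exists_coprime_gt (ltn0Sn n) (fact_gt0 (b + t).-1).
rewrite addnS -addSn (leq_trans _ (leq_mul (leqnn t) m_le)) //.
have m_gt1 : 1 < m by exact: leq_trans nm.
exact: tone_chromatic_Kpow_coprime m_gt1 (ltnW (ltnW nm)) co_m.
Qed.

End CoprimeModulus.

Theorem theorem1p15 (R : realType) (b t : nat) (delta : R) :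
  (1 <= b)%N -> (1 <= t)%N -> 0 < delta ->
  exists N : nat, forall n : nat, (N <= n)%N ->
    (\tau_t (Kpow n b))%:R <= (1 + delta) * t%:R * n%:R.
Proof.
move=> _ _ delta_gt0; pose c := (b + t).-1`!.+1.
exists (Num.truncn (c%:R / delta)).+1 => n ltn.
have c_le : c%:R <= delta * n%:R.
  rewrite mulrC -ler_pdivrMr // ltW // (lt_le_trans (truncnS_gt _)) //.
  by rewrite ler_nat.
have := tone_chromatic_Kpow_le n b t; rewrite -(ler_nat R) => /le_trans; apply.
rewrite natrM natrD -/c [(1 + _) * _]mulrC -mulrA ler_wpM2l //.
by rewrite mulrDl mul1r lerD2l.
Qed.
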